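(* Let $X$ be a Banach space and let $f\in HC^1(X,\mathcal{I})$ be $\preccurlyeq$-lower bounded. If $f$ satisfies the Palais-Smale condition, then $\mathrm{Min}(f,X)\neq\emptyset$.
   Context: $\mathcal{I}=\{[a,b]:a\le b,\ a,b\in\mathbb{R}\}$ is the set of closed bounded real intervals. For $A=[\underline{a},\overline{a}]$, $B=[\underline{b},\overline{b}]$ in $\mathcal{I}$ and $\lambda\in\mathbb{R}$: $A+B=[\underline{a}+\underline{b},\overline{a}+\overline{b}]$; $\lambda A=[\lambda\underline{a},\lambda\overline{a}]$ if $\lambda\ge0$ and $\lambda A=[\lambda\overline{a},\lambda\underline{a}]$ if $\lambda<0$; $A\ominus_{gH}B=[\min\{\underline{a}-\underline{b},\overline{a}-\overline{b}\},\max\{\underline{a}-\underline{b},\overline{a}-\overline{b}\}]$. The Hausdorff distance is $d_H(A,B)=\max\{|\underline{a}-\underline{b}|,|\overline{a}-\overline{b}|\}$; limits of intervals and Hausdorff continuity are with respect to $d_H$. $A\preccurlyeq B$ means $\underline{a}\le\underline{b}$ and $\overline{a}\le\overline{b}$; $A\prec B$ means $\underline{a}<\underline{b}$ and $\overline{a}<\overline{b}$. $f:X\to\mathcal{I}$ is $\preccurlyeq$-lower bounded if there is $A\in\mathcal{I}$ with $A\preccurlyeq f(x)$ for all $x\in X$. A sequence $\{f(x_n)\}$ is $\preccurlyeq$-bounded if there are $A,B\in\mathcal{I}$ with $A\preccurlyeq f(x_n)\preccurlyeq B$ for all $n$. $\mathrm{Min}(f,X)$ is the set of all minimal solutions, i.e.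 of all $x_0\in X$ for which there is no $x\in X$ with $f(x)\prec f(x_0)$. A function $g:X\to\mathcal{I}$ is linear if $g(\lambda x)=\lambda g(x)$ for all $x\in X$, $\lambda\in\mathbb{R}$, and for all $x,y\in X$ either $g(x+y)=g(x)+g(y)$ or $g(x+y)$ and $g(x)+g(y)$ are incomparable with respect to $\preccurlyeq$. $f$ is $gH$-Gâteaux differentiable at $x_0$ if for every $h\in X$ the limit $f'(x_0)(h):=\lim_{t\to0_+}\frac{1}{t}\big(f(x_0+th)\ominus_{gH}f(x_0)\big)$ exists, and $f'(x_0)$ is a Hausdorff continuous and linear interval-valued function from $X$ to $\mathcal{I}$. $HC^1(X,\mathcal{I})$ is the set of all interval-valued functions $f:X\to\mathcal{I}$ that are Hausdorff continuous and $gH$-Gâteaux differentiable (at every point of $X$), and such that for any $h\in X$ the map $f'(\cdot)(h)$ is Hausdorff continuous. $f\in HC^1(X,\mathcal{I})$ satisfies the Palais-Smale condition if any sequence $\{x_n\}$ in $X$ such that (i) $f(x_n)$ is $\preccurlyeq$-bounded, and (ii) for each $h\in X$ with $\|h\|_X=1$, $f'(x_n)(h)\to[0,0]$ or $0\in f'(x_n)(h)$ for $n$ large enough, has a convergent subsequence. Here $\|\cdot\|_X$ is the norm on $X$.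
   Formalization: In Palais-Smale (ii) the two alternatives may mix along n: for each unit h and every ε>0, for all large n, d_H(f'(x_n)(h),[0,0])<ε or 0∈f'(x_n)(h). Read as ''either always tends to [0,0] or eventually contains 0'', the claim fails in infinite dimensions. *)

(* Defs.v *)
From HB Require Import structures.
From mathcomp Require Import all_boot all_order all_algebra.
From mathcomp Require Import all_classical all_reals all_analysis.
Set Implicit Arguments.
Unset Strict Implicit.
Unset Printing Implicit Defensive.
Import Order.TTheory GRing.Theory Num.Theory.
Import numFieldNormedType.Exports.
Local Open Scope classical_set_scope.
Local Open Scope ring_scope.

(* The interval [a, b] is encoded by its pair of endpoints. *)
Record cintv (R : realType) := CIntv {
  endpoints : R * R;
  _ : endpoints.1 <= endpoints.2 }.

HB.instance Definition _ (R : realType) := [isSub for @endpoints R].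
HB.instance Definition _ (R : realType) := [Choice of cintv R by <:].

Section Interval.
Context {R : realType}.
Implicit Types (A B : cintv R) (l a : R).

Definition lo A : R := (endpoints A).1.
Definition hi A : R := (endpoints A).2.

Lemma lo_le_hi A : lo A <= hi A.
Proof. by case: A. Qed.

Lemma cintvP A B : lo A = lo B -> hi A = hi B -> A = B.
Proof.
case: A B => [[a1 a2] pA] [[b1 b2] pB]; rewrite /lo /hi /= => e1 e2.
by apply/val_inj; rewrite /= e1 e2.
Qed.

Definition mkint (a b : R) (ab : a <= b) : cintv R := CIntv (endpoints := (a, b)) ab.

Definition ipoint a : cintv R := mkint (lexx a).
Definition izero : cintv R := ipoint 0.

HB.instance Definition _ := isPointed.Build (cintv R) izero.

Definition imem a A : Prop := lo A <= a /\ a <= hi A.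

Lemma iadd_subproof A B : lo A + lo B <= hi A + hi B.
Proof. by rewrite lerD ?lo_le_hi. Qed.

Definition iadd A B : cintv R := mkint (iadd_subproof A B).

Lemma iscale_subproof l A :
  (if 0 <= l then l * lo A else l * hi A)
    <= (if 0 <= l then l * hi A else l * lo A).
Proof.
have AA := lo_le_hi A; case: (leP 0 l) => l0; first exact: ler_wpM2l.
by rewrite ler_nM2l.
Qed.

Definition iscale l A : cintv R := mkint (iscale_subproof l A).

Lemma gHsub_subproof A B :
  Num.min (lo A - lo B) (hi A - hi B) <= Num.max (lo A - lo B) (hi A - hi B).
Proof. by rewrite ge_min le_max lexx. Qed.

Definition gHsub A B : cintv R := mkint (gHsub_subproof A B).

Definition dH A B : R := Num.max `|lo A - lo B| `|hi A - hi B|.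

Definition ile A B : Prop := lo A <= lo B /\ hi A <= hi B.
Definition ilt A B : Prop := lo A < lo B /\ hi A < hi B.
Definition incomparable A B : Prop := ~ ile A B /\ ~ ile B A.

Lemma dHxx A : dH A A = 0.
Proof. by rewrite /dH !subrr normr0 maxxx. Qed.

Lemma dH_eq0 A B : dH A B = 0 -> A = B.
Proof.
move=> /eqP; rewrite eq_le ge_max !normr_le0 !subr_eq0.
by move=> /andP[/andP[/eqP e1 /eqP e2] _]; exact: cintvP.
Qed.

Lemma dH_sym A B : dH A B = dH B A.
Proof. by rewrite /dH distrC [X in Num.max _ X]distrC. Qed.

Lemma dH_triangle B A C : dH A C <= dH A B + dH B C.
Proof.
rewrite {1}/dH ge_max; apply/andP; split.
- by rewrite (le_trans (ler_distD (lo B) _ _))// lerD// le_max lexx.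
- by rewrite (le_trans (ler_distD (hi B) _ _))// lerD// le_max lexx orbT.
Qed.

HB.instance Definition _ :=
  isMetric.Build R (cintv R) dHxx dH_eq0 dH_sym dH_triangle.

End Interval.

Section IntervalValuedFunctions.
Context {R : realType} {X : normedModType R}.
Implicit Types (f g : X -> cintv R).

Definition ilinear g : Prop :=
  (forall (l : R) (x : X), g (l *: x) = iscale l (g x)) /\
  (forall x y : X, g (x + y) = iadd (g x) (g y) \/
                   incomparable (g (x + y)) (iadd (g x) (g y))).

Definition gHquot f (x h : X) (t : R) : cintv R :=
  iscale t^-1 (gHsub (f (x + t *: h)) (f x)).

(* An arbitrary value when the limit does not exist. *)
Definition gHderiv f (x h : X) : cintv R := lim (gHquot f x h t @[t --> 0^'+]).

Definition gH_differentiable f (x : X) : Prop :=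
  [/\ forall h : X, cvg (gHquot f x h t @[t --> 0^'+]),
      continuous (gHderiv f x) & ilinear (gHderiv f x)].

Definition HC1 f : Prop :=
  [/\ continuous f,
      forall x : X, gH_differentiable f x &
      forall h : X, continuous (fun x => gHderiv f x h)].

Definition ilower_bounded f : Prop := exists A, forall x, ile A (f x).

Definition ibounded_seq (u : nat -> cintv R) : Prop :=
  exists A B, forall n, ile A (u n) /\ ile (u n) B.

(* "u n --> [0, 0] or 0 \in u n, for n large enough": the qualifier governs the
   whole alternative, so that each term with n large either contains 0 or is
   close to [0, 0], and which of the two occurs may depend on n.  The stronger
   reading "either u converges to [0, 0], or 0 \in u n for all large n" admits
   fewer sequences in the Palais-Smale condition below, which then no longer
   ensures the existence of minimal solutions in infinite dimension. *)
Definition vanishing_or_contains0 (u : nat -> cintv R) : Prop :=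
  forall e : R, 0 < e ->
    \forall n \near \oo, dH (u n) izero < e \/ imem 0 (u n).

Definition palais_smale f : Prop :=
  forall x_ : nat -> X,
    ibounded_seq (f \o x_) ->
    (forall h : X, `|h| = 1 ->
       vanishing_or_contains0 (fun n => gHderiv f (x_ n) h)) ->
    exists2 s : nat -> nat, increasing_seq s & cvg ((x_ \o s) n @[n --> \oo]).

Definition Min f : set X := [set x0 | ~ exists x, ilt (f x) (f x0)].

End IntervalValuedFunctions.

(* Main.v *)
Require Import Defs.
From mathcomp Require Import all_boot all_order all_algebra.
From mathcomp Require Import all_classical all_reals all_analysis.
From mathcomp Require Import lra.
Set Implicit Arguments.
Unset Strict Implicit.
Unset Printing Implicit Defensive.
Import Order.TTheory GRing.Theory Num.Theory.
Import numFieldNormedType.Exports.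
Local Open Scope classical_set_scope.
Local Open Scope ring_scope.

(** The proof scalarizes [f] by the sum of endpoints [phi x = lo (f x) + hi (f x)].
A global minimizer of [phi] is a minimal solution, because [f x] strictly below
[f x0] lowers both endpoints and hence their sum.  The function [phi] is
continuous and bounded below, so Ekeland's variational principle ([Ekeland],
[near_minimizer_small_slope]) provides, for every [n], a point [x_ n] where [phi]
is within [1 / (n + 1)] of its infimum and decreases with slope at most
[1 / (n + 1)].

These points form a Palais-Smale sequence for [f].  Their values are bounded,
since the sum of the endpoints is bounded above and each endpoint is bounded
below.  As for the derivatives, the [gH]-difference preserves sums of endpoints
(the minimum and the maximum of two numbers have the same sum as the numbers),
so the small slope passes to the limit of the quotients: the endpoints of
[f'(x_ n)(h)] have sum at least [- 1 / (n + 1)].  The same holds in the direction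
[- h], and [f'(x_ n)(- h) = - f'(x_ n)(h)], whence the sum is at most
[1 / (n + 1)] as well.  An interval whose endpoints have a small sum either
contains [0] or lies on one side of [0], and then both of its endpoints are small
([imem0_or_small]).

The Palais-Smale condition yields a convergent subsequence, and by continuity
[phi] attains its infimum at the limit.

The choice of the sum matters: for [lo f] alone the upper endpoints along a
minimizing sequence may be unbounded, and a small slope of one endpoint does not
control the derivative interval. *)

(** * Ekeland's variational principle *)

Lemma near_minimizer (R : realType) (T : Type) (S : set T) (phi : T -> R)
    (m d : R) :
  S !=set0 -> (forall x, S x -> m <= phi x) -> 0 < d ->
  exists2 x, S x & forall y, S y -> phi x <= phi y + d.
Proof.
move=> [s Ss] lbphi d_gt0.
have hS : has_inf (phi @` S).
  by split; [exists (phi s), s | exists m => _ [x Sx <-]; exact: lbphi].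
have [_ [x Sx <-] ltx] := inf_adherent d_gt0 hS.
exists x => // y Sy; apply: (le_trans (ltW ltx)); rewrite lerD2r.
by apply: (ge_inf hS.2); exists y.
Qed.

Lemma le_addr_harmonic (R : realType) (a b : R) :
  (forall n, a <= b + harmonic n) -> a <= b.
Proof.
move=> ab; apply/ler_addgt0Pr => e e_gt0.
have /cvgr0_norm_lt/(_ _ e_gt0) [n _ /(_ n (leqnn n))] := @cvg_harmonic R.
rewrite ger0_norm ?harmonic_ge0// => ne.
by rewrite (le_trans (ab n))// lerD2l ltW.
Qed.

(** The relation [S x y], i.e. [phi y + e * `|y - x| <= phi x], is a preorder.
Choosing greedily, in the section of [S] above the current point, an almost
smallest value of [phi] gives an [S]-increasing sequence.  Its [phi]-values
decrease and converge, and they dominate distances, so it is a Cauchy sequence.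
A point violating the conclusion at the limit would lie in all the sections, against the
greedy choice. *)
Lemma Ekeland (R : realType) (X : completeNormedModType R) (phi : X -> R)
    (m e : R) (x0 : X) :
  continuous phi -> (forall x, m <= phi x) -> 0 < e ->
  exists2 x, phi x + e * `|x - x0| <= phi x0 &
             forall y, phi x <= phi y + e * `|y - x|.
Proof.
move=> cphi lbphi e_gt0.
pose S x : set X := [set y | phi y + e * `|y - x| <= phi x].
have Sxx x : S x x by rewrite /S/= subrr normr0 mulr0 addr0.
have Strans x y z : S x y -> S y z -> S x z.
  rewrite /S/= => xy yz; have := ler_distD y z x.
  rewrite -(ler_pM2l e_gt0) mulrDr; lra.
have step (p : nat * X) : exists y, S p.2 y /\
    forall z, S p.2 z -> phi y <= phi z + harmonic p.1.
  have [y Sy miny] := near_minimizer (ex_intro _ p.2 (Sxx p.2))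
    (fun x _ => lbphi x) (harmonic_gt0 p.1).
  by exists y.
have [next nextP] := choice step.
pose u := fix u n := if n is k.+1 then next (k, u k) else x0.
have uS k n : (k <= n)%N -> S (u k) (u n).
  elim: n => [|n IHn]; first by rewrite leqn0 => /eqP ->.
  rewrite leq_eqVlt => /predU1P[->//|]; rewrite ltnS => /IHn kn.
  exact: Strans kn (nextP (n, u n)).1.
have Sphi x y : S x y -> phi y <= phi x.
  by rewrite /S/= => xy; have := mulr_ge0 (ltW e_gt0) (normr_ge0 (y - x)); lra.
have phiu_cvg : cvgn (phi \o u).
  apply: nonincreasing_is_cvgn => [k n kn|]; first exact/Sphi/uS.
  by exists m => _ [n _ <-]; exact: lbphi.
have phiu_lim n : limn (phi \o u) <= phi (u n).
  apply: nonincreasing_cvgn_ge => // k i ki; exact/Sphi/uS.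
have : cauchy (u @ \oo).
  apply: cauchy_exP => d d_gt0.
  (* At a rank [k] where [phi (u k)] exceeds its limit by less than [e * d], what
     [phi] can still lose pays for moves of less than [d] away from [u k]. *)
  have ed_gt0 : 0 < e * d by rewrite mulr_gt0.
  have /cvgr_dist_lt/(_ _ ed_gt0) [k _ /(_ k (leqnn k))] := phiu_cvg.
  have := phiu_lim k => lim_le /=; rewrite distrC ger0_norm ?subr_ge0// => close.
  exists (u k); exists k => // n /= kn.
  rewrite -ball_normE/= distrC -(ltr_pM2l e_gt0).
  by have := uS k n kn; have := phiu_lim n; rewrite /S/=; lra.
move=> /cauchy_cvgP; set x := lim (u @ \oo) => ux.
(* The sections of [S] are closed. *)
have xS k : S (u k) x.
  have cF : (fun n => phi (u n) + e * `|u n - u k|) @ \oo -->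
            phi x + e * `|x - u k|.
    apply: cvgD; first exact: (continuous_cvg _ (cphi x) ux).
    apply: cvgMr; apply: cvg_norm; apply: cvgB => //; exact: cvg_cst.
  apply: (cvgr_to_le cF); exists k => // n /= kn; exact: uS.
exists x; first exact: (xS 0%N).
move=> y; rewrite leNgt; apply/negP => yx.
have Sy : S x y by rewrite /S/= ltW.
have : phi x <= phi y.
  apply: le_addr_harmonic => n; apply: le_trans (Sphi _ _ (xS n.+1)) _.
  exact/(nextP (n, u n)).2/(Strans _ _ _ (xS n) Sy).
by have := mulr_ge0 (ltW e_gt0) (normr_ge0 (y - x)); lra.
Qed.

(** Ekeland's point starting from a near minimizer is again a near minimizer. *)
Lemma near_minimizer_small_slope (R : realType) (X : completeNormedModType R)
    (phi : X -> R) (m e : R) :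
  continuous phi -> (forall x, m <= phi x) -> 0 < e ->
  exists x, (forall y, phi x <= phi y + e) /\
            (forall y, phi x <= phi y + e * `|y - x|).
Proof.
move=> cphi lbphi e_gt0.
have [x0 _ x0min] := near_minimizer (ex_intro setT 0 I)
  (fun x _ => lbphi x) e_gt0.
have [x xx0 slope] := Ekeland x0 cphi lbphi e_gt0.
exists x; split=> // y; apply: le_trans (x0min y I).
by have := mulr_ge0 (ltW e_gt0) (normr_ge0 (x - x0)); lra.
Qed.

(** * Sums of endpoints *)

Definition endsum (R : realType) (A : cintv R) : R := lo A + hi A.

Lemma continuous_endsum (R : realType) : continuous (@endsum R).
Proof.
move=> A; apply/(@cvgrPdist_lt _ _ _ (nbhs A) (nbhs_filter A)) => e e_gt0.
have e2_gt0 : 0 < e / 2 by rewrite divr_gt0.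
near=> B.
have : ball A (e / 2) B by near: B; exact: nbhsx_ballx.
rewrite /ball/= /dH gt_max => /andP[]; rewrite /endsum.
rewrite !ltr_norml => /andP[? ?] /andP[? ?]; apply/andP; split; lra.
Unshelve. all: by end_near.
Qed.

(** Taking the minimum and the maximum in the [gH]-difference only permutes the
two endpoint differences, so it disappears in the sum. *)
Lemma endsum_gHquot (R : realType) (X : normedModType R) (f : X -> cintv R)
    (x h : X) (t : R) :
  0 < t ->
  endsum (gHquot f x h t) = t^-1 * (endsum (f (x + t *: h)) - endsum (f x)).
Proof.
move=> t_gt0; rewrite /endsum /gHquot /iscale /gHsub /lo /hi /=.
rewrite invr_ge0 (ltW t_gt0) -mulrDr addr_min_max.
by congr (_ * _); lra.
Qed.

Lemma endsum_gHderiv_ge (R : realType) (X : normedModType R)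
    (f : X -> cintv R) (x h : X) (e : R) :
  cvg (gHquot f x h t @[t --> 0^'+]) -> `|h| = 1 ->
  (forall y, endsum (f x) <= endsum (f y) + e * `|y - x|) ->
  - e <= endsum (gHderiv f x h).
Proof.
move=> df h1 slope.
have quot_cvg : endsum (gHquot f x h t) @[t --> 0^'+] -->
                endsum (gHderiv f x h).
  exact: (continuous_cvg _ (@continuous_endsum R _) df).
apply: (cvgr_to_ge quot_cvg).
near=> t.
have t_gt0 : 0 < t by near: t; exact: nbhs_right_gt.
rewrite endsum_gHquot// ler_pdivlMl//.
have := slope (x + t *: h).
rewrite [X in `|X|]addrAC subrr add0r normrZ h1 mulr1 gtr0_norm//; lra.
Unshelve. all: by end_near.
Qed.

Lemma endsum_iscaleN1 (R : realType) (A : cintv R) :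
  endsum (iscale (- 1) A) = - endsum A.
Proof.
rewrite /endsum /lo /hi /= oppr_ge0 ler10; lra.
Qed.

(** If [0] is outside the interval, both endpoints have the same sign, so that
the absolute value of each is at most that of their sum. *)
Lemma imem0_or_small (R : realType) (A : cintv R) (e : R) :
  - e <= endsum A <= e -> imem 0 A \/ dH A izero <= e.
Proof.
move=> /andP[eA Ae]; have := lo_le_hi A; move: eA Ae; rewrite /endsum => eA Ae lohi.
have [lo_le0|lo_gt0] := leP (lo A) 0; last first.
  right; rewrite /dH !subr0 ge_max !ler_norml; apply/andP; split; lra.
have [hi_ge0|hi_lt0] := leP 0 (hi A); first by left.
right; rewrite /dH !subr0 ge_max !ler_norml; apply/andP; split; lra.
Qed.

(** The one-sided derivative gives only a lower bound in the direction [h]; the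
upper bound is the lower bound in the direction [- h], since the derivative is
homogeneous for negative scalars too. *)
Lemma small_slope_gHderiv (R : realType) (X : normedModType R)
    (f : X -> cintv R) (x h : X) (e : R) :
  gH_differentiable f x -> `|h| = 1 ->
  (forall y, endsum (f x) <= endsum (f y) + e * `|y - x|) ->
  imem 0 (gHderiv f x h) \/ dH (gHderiv f x h) izero <= e.
Proof.
move=> [df _ [homog _]] h1 slope; apply: imem0_or_small; apply/andP; split.
  exact: endsum_gHderiv_ge.
have := endsum_gHderiv_ge (df (- h)) (etrans (normrN h) h1) slope.
by rewrite -(scaleN1r h) homog endsum_iscaleN1 lerN2.
Qed.

(** * Existence of minimal solutions *)

Theorem theorem4p4 (R : realType) (X : completeNormedModType R)
    (f : X -> cintv R)
    (f_HC1 : HC1 f)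
    (f_lower_bounded : ilower_bounded f)
    (f_PS : palais_smale f) :
  Min f !=set0.
Proof.
have [f_cont f_diff _] := f_HC1; have [A Af] := f_lower_bounded.
pose phi := @endsum R \o f.
have phi_cont : continuous phi.
  by move=> x; apply: continuous_comp; [exact: f_cont|exact: continuous_endsum].
have phi_ge x : endsum A <= phi x by rewrite lerD//; have [] := Af x.
have /choice[x_ x_P] n := near_minimizer_small_slope
  phi_cont phi_ge (harmonic_gt0 n).
(* The sum of the endpoints of [f (x_ n)] is at most [phi 0 + 1]; bounding one
   endpoint below by that of [A] bounds the other one above. *)
have bounded_fx : ibounded_seq (f \o x_).
  have hB : phi 0 + 1 - hi A <= phi 0 + 1 - lo A.
    by rewrite lerD2l lerN2 lo_le_hi.
  exists A, (mkint hB) => n; split; first exact: Af.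
  have harm1 : harmonic n <= 1 :> R by rewrite /= invf_le1 ?ltr0n// ler1n.
  have := le_trans ((x_P n).1 0) (lerD (lexx _) harm1).
  have [] := Af (x_ n); rewrite /phi /endsum /ile /lo /hi /=.
  by move=> ? ? ?; split; lra.
have vanishing h : `|h| = 1 ->
    vanishing_or_contains0 (fun n => gHderiv f (x_ n) h).
  move=> h1 e e_gt0.
  have harm_lt : \forall n \near \oo, `|harmonic n : R| < e.
    exact: (cvgr0_norm_lt _ (@cvg_harmonic R)).
  apply: filterS harm_lt => n; rewrite ger0_norm ?harmonic_ge0// => ne.
  have [|small] := small_slope_gHderiv (f_diff _) h1 (x_P n).2.
    by right.
  by left; exact: le_lt_trans ne.
have [s s_incr sx] := f_PS x_ bounded_fx vanishing.
set x := lim (_ @ _) in sx.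
have minx y : phi x <= phi y.
  apply: le_addr_harmonic => k.
  have phi_sx : phi (x_ (s n)) @[n --> \oo] --> phi x.
    exact: (continuous_cvg _ (phi_cont x) sx).
  apply: (cvgr_to_le phi_sx).
  have s_ge n : (n <= s n)%N.
    elim: n => // n IHn; apply: leq_ltn_trans IHn _.
    by move: (s_incr n.+1 n); rewrite /= leEnat ltnn ltnNge => ->.
  exists k => // n /= kn; apply: le_trans ((x_P (s n)).1 y) _.
  rewrite lerD2l /harmonic/= lef_pV2 ?posrE ?ltr0n// ler_nat ltnS.
  exact: leq_trans kn (s_ge n).
exists x => -[y [lo_yx hi_yx]].
by have := minx y; rewrite /phi /= /endsum; lra.
Qed.
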